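(* There exist universal constants $c>0$ and $\epsilon_0>0$ such that the following holds for all integers $n\ge 2$, all $\epsilon\in(0,\epsilon_0]$ and all integers $k\ge 1$. Let $\pi$ be a signaling scheme (with any finite signal set) in the flower game $G^{\frac{1}{2(n-1)},n}$ that is $\epsilon$-optimal in the known-commitment setting, i.e. $BPR(\pi)\ge \max_{\pi'}BPR(\pi')-\epsilon$. If $IR_k(\pi)\ge \max_{\pi'}BPR(\pi')-\epsilon$, then $$k\;\ge\; c\,\frac{n}{\epsilon^2\left(\epsilon+\frac1n\right)} .$$
   Context: Bayesian persuasion: a problem is a tuple $(\Omega,A,u_S,u_R,\mu)$ with finite state set $\Omega$, finite action set $A$, sender and receiver utilities $u_S,u_R:\Omega\times A\to\mathbb{R}$ (with $u_S(:,a),u_R(:,a)\in\mathbb{R}^\Omega$ the vectors for action $a$), and state distribution $\mu\in\Delta^\Omega$. A signaling scheme is $\pi:\Omega\to\Delta^S$ for a finite signal set $S$; $p^\pi(\omega,s)=\mu(\omega)\pi(\omega,s)$, $p^\pi(s)=\sum_\omega p^\pi(\omega,s)$ (assumed positive for every $s\in S$), posterior $y^\pi_s(\omega)=p^\pi(\omega,s)/p^\pi(s)$. For $x\in\Delta^\Omega$, $a(x)$ is an element of $\arg\max_{a\in A}\langle u_R(:,a),x\rangle$, ties broken in favor of an action maximizing $\langle u_S(:,a),x\rangle$ (remaining ties by a fixed selection); $E_a=\{y\in\Delta^\Omega:a(y)=a\}$, $a^\pi(s)=a(y^\pi_s)$. Known-commitment value: $BPR(\pi)=\mathbb{E}_{\omega\sim\mu,\,s\sim\pi(\omega)}[u_S(\omega,a^\pi(s))]$.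 Inference setting at round $k\ge1$: let $Z\sim\mathsf{Multi}(k-1,p^\pi)$ (counts on $\Omega\times S$) and, for each $s$, independently $Y_s\sim\mathsf{Multi}(1,y^\pi_s)$; counts $\#(\omega,s)_k=Z(\omega,s)+Y_s(\omega)$; posterior estimate $\hat y^\pi_{s,k}(\omega)=\#(\omega,s)_k/\sum_{\omega'}\#(\omega',s)_k$; on signal $s$ the receiver takes action $a(\hat y^\pi_{s,k})$. The sender's round-$k$ reward is $IR_k(\pi)=\sum_{s\in S}p^\pi(s)\sum_{a\in A}\langle u_S(:,a),y^\pi_s\rangle\,\mathbb{P}[\hat y^\pi_{s,k}\in E_a]$. Flower game $G^{\tau,n}$ ($\tau\in[0,1/n]$): states $\Omega_n=[n]=\{1,\dots,n\}$, $\mu_n(i)=1/n$; actions $A_n=\{a_j\}_{j\in[n]}\cup\{a_{(j\ell)}: j\in[n],\ \ell\in[n]\setminus\{j\}\}$; receiver utility $u_R(:,a_j)=e_j$ and $u_R(:,a_{(j\ell)})=e_j+\tau\mathbf{1}-e_\ell$; sender utility $u_S(:,a_j)=e_j$ and $u_S(:,a_{(j\ell)})=\mathbf{0}$. Here $e_j$ is the $j$-th standard basis vector of $\mathbb{R}^n$, $\mathbf 1$ the all-ones vector and $\mathbf{0}$ the zero vector. Here $\tau=\frac{1}{2(n-1)}$. *)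

(* Defs.v *)
From mathcomp Require Import all_boot all_order all_algebra.
From mathcomp Require Import classical_sets reals.

Set Implicit Arguments.
Unset Strict Implicit.
Unset Printing Implicit Defensive.

Import Order.TTheory GRing.Theory Num.Theory.
Local Open Scope ring_scope.

Definition in_simplex (R : realType) (T : finType) (x : {ffun T -> R}) : bool :=
  [forall t, 0 <= x t] && (\sum_t x t == 1).

Definition dotp (R : realType) (T : finType) (u x : {ffun T -> R}) : R :=
  \sum_t u t * x t.

(* uS P a is the vector u_S(:, a), and likewise uR. *)
Record problem (R : realType) (Omega A : finType) := Problem {
  uS : A -> {ffun Omega -> R};
  uR : A -> {ffun Omega -> R};
  prior : {ffun Omega -> R};
  prior_simplex : in_simplex prior
}.

Record scheme (R : realType) (Omega A : finType) (P : problem R Omega A)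
    (S : finType) := Scheme {
  sprob :> Omega -> {ffun S -> R};
  sprob_simplex : forall w, in_simplex (sprob w);
  sprob_full : forall s, 0 < \sum_w prior P w * sprob w s
}.

Section Persuasion.
Variables (R : realType) (Omega A : finType) (P : problem R Omega A).

Definition receiver_optimal (x : {ffun Omega -> R}) (a : A) : Prop :=
  forall b, dotp (uR P b) x <= dotp (uR P a) x.

(* A map x |-> a(x) choosing a receiver-optimal action, ties being broken in
   favor of the sender.  How the remaining ties are resolved is left arbitrary;
   values outside the simplex are irrelevant. *)
Definition action_rule (act : {ffun Omega -> R} -> A) : Prop :=
  forall x, in_simplex x ->
    receiver_optimal x (act x) /\
    forall b, receiver_optimal x b -> dotp (uS P b) x <= dotp (uS P (act x)) x.

Definition E_ (act : {ffun Omega -> R} -> A) (a : A) : pred {ffun Omega -> R} :=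
  fun y => in_simplex y && (act y == a).

Definition joint (S : finType) (pi : scheme P S) : {ffun Omega * S -> R} :=
  [ffun ws => prior P ws.1 * pi ws.1 ws.2].

Definition sig_prob (S : finType) (pi : scheme P S) (s : S) : R :=
  \sum_w joint pi (w, s).

Definition posterior (S : finType) (pi : scheme P S) (s : S) :
    {ffun Omega -> R} :=
  [ffun w => joint pi (w, s) / sig_prob pi s].

Definition BPR (act : {ffun Omega -> R} -> A) (S : finType)
    (pi : scheme P S) : R :=
  \sum_w prior P w * \sum_s pi w s * uS P (act (posterior pi s)) w.

(* The maximum of BPR over all schemes with any finite signal set; it is
   attained, since sender-favorable tie-breaking makes the sender's value
   upper semicontinuous in the posterior. *)
Definition maxBPR (act : {ffun Omega -> R} -> A) : R :=
  sup [set v : R | exists (S : finType) (pi : scheme P S), v = BPR act pi].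

End Persuasion.

(* Probability mass function of Multi(N, p): counts never exceed N, hence the
   codomain 'I_N.+1. *)
Definition multi (R : realType) (T : finType) (N : nat) (p : {ffun T -> R})
    (z : {ffun T -> 'I_N.+1}) : R :=
  if (\sum_t z t == N)%N
  then N`!%:R / (\prod_t (z t)`!)%N%:R * \prod_t p t ^+ z t
  else 0.

Section Inference.
Variables (R : realType) (Omega A : finType) (P : problem R Omega A).
Variables (S : finType) (k : nat).

(* An outcome is a pair (Z, (Y_s)_s). *)
Definition outcome : finType :=
  ({ffun Omega * S -> 'I_k.-1.+1} * {ffun S -> {ffun Omega -> 'I_2}})%type.

Definition outcome_prob (pi : scheme P S) (o : outcome) : R :=
  multi (joint pi) o.1 * \prod_s multi (posterior pi s) (o.2 s).

Definition Prob (pi : scheme P S) (E : pred outcome) : R :=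
  \sum_(o | E o) outcome_prob pi o.

Definition nb (o : outcome) (w : Omega) (s : S) : nat :=
  (o.1 (w, s) + o.2 s w)%N.

Definition estimate (o : outcome) (s : S) : {ffun Omega -> R} :=
  [ffun w => (nb o w s)%:R / (\sum_w' nb o w' s)%N%:R].

End Inference.

Definition IR (R : realType) (Omega A : finType) (P : problem R Omega A)
    (act : {ffun Omega -> R} -> A) (k : nat) (S : finType)
    (pi : scheme P S) : R :=
  \sum_s sig_prob pi s *
    \sum_a dotp (uS P a) (posterior pi s) *
           Prob pi (fun o : outcome Omega S k => E_ act a (estimate R o s)).

Section Flower.
Variables (R : realType) (n : nat).

Definition basis (j : 'I_n) : {ffun 'I_n -> R} := [ffun i => (i == j)%:R].

(* inl j is a_j, and inr of the pair (j, l), j != l, is a_(jl). *)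
Definition flower_action : finType :=
  ('I_n + {jl : 'I_n * 'I_n | jl.1 != jl.2})%type.

Definition flower_uS (a : flower_action) : {ffun 'I_n -> R} :=
  match a with
  | inl j => basis j
  | inr _ => [ffun=> 0]
  end.

Definition flower_uR (tau : R) (a : flower_action) : {ffun 'I_n -> R} :=
  match a with
  | inl j => basis j
  | inr jl => [ffun i => basis (val jl).1 i + tau - basis (val jl).2 i]
  end.

Definition flower_prior : {ffun 'I_n -> R} := [ffun=> n%:R^-1].

Lemma flower_prior_simplex : (0 < n)%N -> in_simplex flower_prior.
Proof.
move=> n_gt0; apply/andP; split.
  by apply/forallP => i; rewrite ffunE invr_ge0 ler0n.
under eq_bigr do rewrite ffunE.
by rewrite sumr_const card_ord -[X in X == _]mulr_natr mulVf // pnatr_eq0 -lt0n.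
Qed.

Definition flower (tau : R) (n_gt0 : (0 < n)%N) : problem R 'I_n flower_action :=
  Problem flower_uS (flower_uR tau) (flower_prior_simplex n_gt0).

End Flower.

(* Main.v *)
Require Import Defs.
From mathcomp Require Import all_boot all_order all_algebra.
From mathcomp Require Import reals.
From mathcomp Require Import ring lra zify.

(** The optimal known-commitment value is at least 1/2: signal each state [s]
    with posterior 1/2 at [s] and [tau] elsewhere.  An action [a_j] is taken only
    at posteriors [x] with [x j <= 1/2] and all coordinates at least [tau].
    Averaging [3 * (known-commitment value) + (round-k reward)] over the signals
    produces one signal [s] whose posterior has [j]-th coordinate at least
    [1/2 - 2 eps] and whose estimate keeps every coordinate above [tau] with
    probability at least [1 - 8 eps].  Some petal [l] then has posterior
    [tau + O(eps / n)], so the excess [W] of the count of [l] over [tau] times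
    the number of samples has mean [a = O(m eps / n)], where
    [m = 1 + (k - 1) p(s)] is the expected number of samples of [s], while its
    standard deviation [sigma] is at least of order [sqrt (m / n)].  The event
    [W >= 0] can have probability close to 1 only if [a] is at least a constant multiple of [sigma]
    (by anti-concentration when [m] times the posterior of [l] is at least 3/4,
    and since the count of [l] is then often 0 otherwise), that is
    [m >= c n / eps^2].  Finally [p(s) <= 3 / n] because the prior of [j] is
    [1 / n]; this even gives [k >= c n^2 / eps^2]. *)

Set Implicit Arguments.
Unset Strict Implicit.
Unset Printing Implicit Defensive.

Import Order.TTheory GRing.Theory Num.Theory.
Local Open Scope ring_scope.

(** * Multinomial moments *)

Section MultinomialMoments.
Variables (R : realType) (T : finType).
Implicit Types (N : nat) (p f : {ffun T -> R}) (G : R -> R).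

Definition lin_stat N f (z : {ffun T -> 'I_N.+1}) : R :=
  \sum_t (z t)%:R * f t.

(** A general test function [G] lets one draw be absorbed as a shift of [G], so that moments follow
    by induction on [N]. *)
Definition multi_mean N p f G : R :=
  \sum_(z : {ffun T -> 'I_N.+1}) multi p z * G (lin_stat f z).

Definition incr_at N (t : T) (z : {ffun T -> 'I_N.+1}) : {ffun T -> 'I_N.+2} :=
  [ffun u => inord (z u + (u == t))].

Definition decr_at N (t : T) (z : {ffun T -> 'I_N.+2}) : {ffun T -> 'I_N.+1} :=
  [ffun u => inord (z u - (u == t))].

Lemma incr_atE N t (z : {ffun T -> 'I_N.+1}) u :
  incr_at t z u = (z u + (u == t))%N :> nat.
Proof. by rewrite ffunE inordK //; have := ltn_ord (z u); case: (u == t); lia. Qed.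

Lemma decr_atE N t (z : {ffun T -> 'I_N.+2}) u :
  (\sum_v z v = N.+1)%N -> (0 < z t)%N ->
  decr_at t z u = (z u - (u == t))%N :> nat.
Proof.
move=> sz zt; rewrite ffunE inordK //.
have [->|ut] := eqVneq u t; first by have := ltn_ord (z t); lia.
have := sz; rewrite (bigD1 t) //= (bigD1 u) //=; lia.
Qed.

Lemma decr_at_incr N t (z : {ffun T -> 'I_N.+1}) : decr_at t (incr_at t z) = z.
Proof.
apply/ffunP => u; apply: val_inj; rewrite /= ffunE incr_atE addnK inordK //.
Qed.

Lemma sum_incr_at N t (z : {ffun T -> 'I_N.+1}) :
  (\sum_u incr_at t z u = (\sum_u z u).+1)%N.
Proof.
under eq_bigr do rewrite incr_atE.
rewrite big_split /= -[RHS]addn1; congr addn.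
by rewrite (bigD1 t) //= eqxx big1 // => u /negPf ->.
Qed.

Lemma lin_stat_incr_at N f t (z : {ffun T -> 'I_N.+1}) :
  lin_stat f (incr_at t z) = lin_stat f z + f t.
Proof.
rewrite /lin_stat; under eq_bigr do rewrite incr_atE natrD mulrDl.
rewrite big_split /=; congr (_ + _).
rewrite (bigD1 t) //= eqxx mul1r big1 ?addr0 // => u /negPf ->.
by rewrite mul0r.
Qed.

(** Conditioning on one draw: the counts sum to [N.+1], so the mass splits into shares proportional
    to [z t], and [z t] cancels against its factorial. *)
Lemma multi_decr N p (z : {ffun T -> 'I_N.+2}) : (\sum_t z t = N.+1)%N ->
  multi p z = \sum_(t | (0 < z t)%N) p t * multi p (decr_at t z).
Proof.
move=> sz; rewrite {1}/multi sz eqxx.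
pose C : R := N`!%:R / (\prod_t (z t)`!)%N%:R * \prod_t p t ^+ z t.
transitivity (\sum_t C * (z t)%:R).
  rewrite -mulr_sumr -natr_sum sz /C factS natrM.
  by set X := _^-1; set Y := \prod_t _; ring.
rewrite [RHS]big_mkcond; apply: eq_bigr => t _.
case: ifP => [zt|]; last by rewrite lt0n => /negbFE/eqP ->; rewrite mulr0.
have dE u := decr_atE u sz zt.
rewrite /multi; have -> : (\sum_u decr_at t z u == N)%N.
  under eq_bigr do rewrite dE.
  move: sz; rewrite (bigD1 t) //= => sz.
  rewrite (bigD1 t) //= eqxx.
  under eq_bigr => u /negPf -> do rewrite subn0.
  apply/eqP; move: zt sz; case: (nat_of_ord (z t)) => // m _.
  by rewrite addSn subn1 => -[].
have facE : (\prod_u (z u)`! = z t * \prod_u (decr_at t z u)`!)%N.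
  rewrite (bigD1 t) //= [in RHS](bigD1 t) //= mulnA dE eqxx subn1.
  congr muln; first by case: (nat_of_ord (z t)) zt => // m _; rewrite factS.
  by apply: eq_bigr => u /negPf h; rewrite dE h subn0.
have powE : \prod_u p u ^+ z u = p t * \prod_u p u ^+ decr_at t z u.
  rewrite (bigD1 t) //= [in RHS](bigD1 t) //= mulrA dE eqxx subn1.
  congr (_ * _); first by case: (nat_of_ord (z t)) zt => // m _; rewrite exprS.
  by apply: eq_bigr => u /negPf h; rewrite dE h subn0.
rewrite /C facE powE natrM.
have z0 : (z t)%:R != 0 :> R by rewrite pnatr_eq0 -lt0n.
have D0 : (\prod_u (decr_at t z u)`!)%N%:R != 0 :> R.
  by rewrite pnatr_eq0 -lt0n prodn_gt0 // => u; rewrite fact_gt0.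
by field; rewrite D0 z0.
Qed.

(** From here on moments are computed by this recursion instead of the explicit mass function. *)
Lemma multi_meanS N p f G : multi_mean N.+1 p f G =
  \sum_t p t * multi_mean N p f (fun x => G (x + f t)).
Proof.
rewrite /multi_mean (bigID (fun z : {ffun T -> 'I_N.+2} => \sum_t z t == N.+1)%N) /=.
rewrite [X in _ + X]big1 ?addr0; last first.
  by move=> z /negPf h; rewrite /multi h mul0r.
under eq_bigr => z /eqP sz do rewrite multi_decr // mulr_suml big_mkcond.
rewrite exchange_big; apply: eq_bigr => t _ /=.
rewrite -big_mkcondr mulr_sumr.
(* [incr_at t] is a bijection from the counts of total [N] onto those of total [N.+1] in which [t]
   occurs. *)
rewrite (reindex_onto (@incr_at N t) (@decr_at N t)) /=; last first.
  move=> z /andP[/eqP sz zt]; apply/ffunP => u; apply: val_inj.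
  rewrite /= incr_atE decr_atE // subnK //.
  by case: eqVneq => [->|_]; rewrite ?leq0n.
rewrite [RHS](bigID (fun z : {ffun T -> 'I_N.+1} => \sum_t z t == N)%N) /=.
rewrite [X in _ = _ + X]big1 ?addr0; last first.
  by move=> z /negPf h; rewrite /multi h mul0r mulr0.
apply: eq_big => z.
  by rewrite decr_at_incr eqxx sum_incr_at eqSS incr_atE eqxx addn1 !andbT.
by move=> _; rewrite decr_at_incr lin_stat_incr_at mulrA.
Qed.

Lemma multi_mean0 p f G : multi_mean 0 p f G = G 0.
Proof.
rewrite /multi_mean (bigD1 [ffun=> ord0]) //= big1 ?addr0.
  rewrite /multi /lin_stat big1 => [|t _]; last by rewrite ffunE.
  rewrite eqxx big1 => [|t _]; last by rewrite ffunE.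
  rewrite big1 => [|t _]; last by rewrite ffunE expr0.
  rewrite big1 => [|t _]; last by rewrite ffunE mul0r.
  by rewrite fact0 divr1 !mul1r.
move=> z /eqP []; apply/ffunP => t; rewrite ffunE; exact: ord1.
Qed.

Lemma eq_multi_mean N p f G H : G =1 H -> multi_mean N p f G = multi_mean N p f H.
Proof. by move=> e; apply: eq_bigr => z _; rewrite e. Qed.

Lemma multi_mean_cst N p f c : \sum_t p t = 1 -> multi_mean N p f (fun=> c) = c.
Proof.
move=> p1; elim: N => [|N IH]; first by rewrite multi_mean0.
by rewrite multi_meanS -mulr_suml p1 mul1r.
Qed.

Lemma multi_mean_id N p f c : \sum_t p t = 1 ->
  multi_mean N p f (fun x => x + c) = N%:R * (\sum_t p t * f t) + c.
Proof.
move=> p1; elim: N c => [|N IH] c; first by rewrite multi_mean0 mul0r.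
rewrite multi_meanS.
under eq_bigr => t _ do under eq_multi_mean => x do rewrite -addrA.
under eq_bigr do rewrite IH !mulrDr.
rewrite !big_split /= -!mulr_suml p1 -natr1.
by rewrite /=; ring.
Qed.

(** Exactly [N] draws are made, so lowering [f] by [c] lowers the statistic by [N * c]. *)
Lemma multi_mean_center N p f c G :
  multi_mean N p f G = multi_mean N p [ffun t => f t - c] (fun x => G (x + N%:R * c)).
Proof.
elim: N G => [|N IH] G; first by rewrite !multi_mean0 mul0r addr0.
rewrite !multi_meanS; apply: eq_bigr => t _; congr (_ * _).
rewrite IH; apply: eq_multi_mean => x; congr G.
by rewrite ffunE -natr1; ring.
Qed.

Lemma sum_quartic p f c0 c1 c2 c3 c4 : \sum_t p t = 1 ->
  \sum_t p t * (c0 + c1 * f t + c2 * f t ^+ 2 + c3 * f t ^+ 3 + c4 * f t ^+ 4) =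
  c0 + c1 * (\sum_t p t * f t) + c2 * (\sum_t p t * f t ^+ 2)
     + c3 * (\sum_t p t * f t ^+ 3) + c4 * (\sum_t p t * f t ^+ 4).
Proof.
move=> p1; under eq_bigr do rewrite !mulrDr.
rewrite !big_split /= -mulr_suml p1 mul1r !mulr_sumr.
by congr (_ + _ + _ + _ + _); apply: eq_bigr => t _; rewrite mulrCA.
Qed.

(** Moments of a sum of [N] independent centered variables. All coefficients stay general because
    shifting by one draw feeds the higher ones into the lower ones. *)
Lemma multi_mean_quartic N p f c0 c1 c2 c3 c4 :
  \sum_t p t = 1 -> \sum_t p t * f t = 0 ->
  let m2 := \sum_t p t * f t ^+ 2 in
  let m3 := \sum_t p t * f t ^+ 3 in
  let m4 := \sum_t p t * f t ^+ 4 in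
  multi_mean N p f (fun x => c0 + c1 * x + c2 * x ^+ 2 + c3 * x ^+ 3 + c4 * x ^+ 4)
  = c0 + c2 * (N%:R * m2) + c3 * (N%:R * m3)
       + c4 * (N%:R * m4 + 3 * N%:R * (N%:R - 1) * m2 ^+ 2).
Proof.
move=> p1 f0 m2 m3 m4; elim: N c0 c1 c2 c3 c4 => [|N IH] c0 c1 c2 c3 c4.
  by rewrite multi_mean0; ring.
rewrite multi_meanS.
pose n : R := N%:R.
transitivity (\sum_t p t * (
  (c0 + c2 * (n * m2) + c3 * (n * m3) + c4 * (n * m4 + 3 * n * (n - 1) * m2 ^+ 2))
  + (c1 + 3 * c3 * (n * m2) + 4 * c4 * (n * m3)) * f t
  + (c2 + 6 * c4 * (n * m2)) * f t ^+ 2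
  + c3 * f t ^+ 3 + c4 * f t ^+ 4)).
  apply: eq_bigr => t _; congr (_ * _).
  pose x := f t; rewrite -/x.
  rewrite (@eq_multi_mean _ _ _ _ (fun y =>
    (c0 + c1 * x + c2 * x ^+ 2 + c3 * x ^+ 3 + c4 * x ^+ 4)
    + (c1 + 2 * c2 * x + 3 * c3 * x ^+ 2 + 4 * c4 * x ^+ 3) * y
    + (c2 + 3 * c3 * x + 6 * c4 * x ^+ 2) * y ^+ 2
    + (c3 + 4 * c4 * x) * y ^+ 3 + c4 * y ^+ 4)); last by move=> y; ring.
  by rewrite IH -/n; ring.
rewrite sum_quartic // f0 -/m2 -/m3 -/m4 -natr1 -/n.
by ring.
Qed.

End MultinomialMoments.

(** The extra independent draw from a second law will be the sample [Y_s]. *)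
Lemma multi_mean_quartic_add (R : realType) (T U : finType) N
    (p f : {ffun T -> R}) (q g : {ffun U -> R}) c0 c1 c2 c3 c4 :
  \sum_t p t = 1 -> \sum_t p t * f t = 0 ->
  \sum_u q u = 1 -> \sum_u q u * g u = 0 ->
  let m2 := \sum_t p t * f t ^+ 2 in
  let m3 := \sum_t p t * f t ^+ 3 in
  let m4 := \sum_t p t * f t ^+ 4 in
  let v2 := \sum_u q u * g u ^+ 2 in
  let v3 := \sum_u q u * g u ^+ 3 in
  let v4 := \sum_u q u * g u ^+ 4 in
  \sum_u q u * multi_mean N p f (fun x => c0 + c1 * (x + g u)
     + c2 * (x + g u) ^+ 2 + c3 * (x + g u) ^+ 3 + c4 * (x + g u) ^+ 4)
  = c0 + c2 * (N%:R * m2 + v2) + c3 * (N%:R * m3 + v3)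
       + c4 * (N%:R * m4 + 3 * N%:R * (N%:R - 1) * m2 ^+ 2
               + 6 * N%:R * m2 * v2 + v4).
Proof.
move=> p1 f0 q1 g0 m2 m3 m4 v2 v3 v4.
pose n : R := N%:R.
transitivity (\sum_u q u * (
  (c0 + c2 * (n * m2) + c3 * (n * m3) + c4 * (n * m4 + 3 * n * (n - 1) * m2 ^+ 2))
  + (c1 + 3 * c3 * (n * m2) + 4 * c4 * (n * m3)) * g u
  + (c2 + 6 * c4 * (n * m2)) * g u ^+ 2
  + c3 * g u ^+ 3 + c4 * g u ^+ 4)).
  apply: eq_bigr => u _; congr (_ * _).
  pose x := g u; rewrite -/x.
  rewrite (@eq_multi_mean _ _ _ _ _ _ (fun y =>
    (c0 + c1 * x + c2 * x ^+ 2 + c3 * x ^+ 3 + c4 * x ^+ 4)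
    + (c1 + 2 * c2 * x + 3 * c3 * x ^+ 2 + 4 * c4 * x ^+ 3) * y
    + (c2 + 3 * c3 * x + 6 * c4 * x ^+ 2) * y ^+ 2
    + (c3 + 4 * c4 * x) * y ^+ 3 + c4 * y ^+ 4)); last by move=> y; ring.
  by rewrite multi_mean_quartic // -/m2 -/m3 -/m4 -/n; ring.
rewrite sum_quartic // g0 -/v2 -/v3 -/v4 -/n.
by ring.
Qed.

(** * Anti-concentration of the empirical frequency *)

(** The product is negative only between [- (4 * s)] and [- a]. There AM-GM bounds the first two
    factors by [4 * s ^+ 2] in absolute value, and the base of the square by [8 * s]. The double
    root makes the four roots sum to zero. *)
Lemma quartic_lower_bound (R : realType) (s a x : R) : 0 < s -> 0 <= a -> a <= s ->
  - (256 * s ^+ 4) <= (x + a) * (x + 4 * s) * (x - (a + 4 * s) / 2) ^+ 2.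
Proof.
move=> s0 a0 as_.
have s4 : 0 <= 256 * s ^+ 4 by rewrite mulr_ge0 // exprn_ge0 // ltW.
have pos : 0 <= (x + a) * (x + 4 * s) ->
    - (256 * s ^+ 4) <= (x + a) * (x + 4 * s) * (x - (a + 4 * s) / 2) ^+ 2.
  move=> h; apply: (@le_trans _ _ 0); first by rewrite oppr_le0.
  by rewrite mulr_ge0 // sqr_ge0.
have [xa|xa] := lerP (- a) x.
  by apply: pos; rewrite mulr_ge0 //; lra.
have [xb|xb] := lerP x (- (4 * s)).
  by apply: pos; rewrite mulr_le0 //; lra.
rewrite lerNl -mulNr -[- ((x + a) * _)]mulNr.
have -> : 256 * s ^+ 4 = 4 * s ^+ 2 * (8 * s) ^+ 2 by ring.
apply: ler_pM; [|exact: sqr_ge0| |].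
- by rewrite mulr_ge0 //; lra.
- set u := - (x + a); have u0 : 0 <= u by rewrite /u; lra.
  have uv : 0 <= (u - (x + 4 * s)) ^+ 2 by apply: sqr_ge0.
  have : 0 <= (8 * s - a) * a by rewrite mulr_ge0 //; lra.
  by rewrite /u in uv *; lra.
- set y := x - _; have : 0 <= (8 * s - y) * (8 * s + y).
    by rewrite mulr_ge0 // /y; lra.
  by lra.
Qed.

(* The cubic coefficient of the quartic vanishes, so its mean under a centered
   law only involves the second and fourth moments. *)
Lemma indicator_le_quartic (R : realType) (s a x : R) :
  0 < s -> 0 <= a -> a <= s ->
  ((- a <= x)%R)%:R <= 1 + (x + a) * (x + 4 * s) * (x - (a + 4 * s) / 2) ^+ 2
                       / (256 * s ^+ 4).
Proof.
move=> s0 a0 as_.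
have s4 : 0 < 256 * s ^+ 4 by rewrite mulr_gt0 // exprn_gt0.
have [xa|xa] := lerP (- a) x.
  rewrite lerDl divr_ge0 ?(ltW s4) // mulr_ge0 ?sqr_ge0 // mulr_ge0 //; lra.
rewrite -lerBlDl sub0r ler_pdivlMr // mulN1r.
exact: quartic_lower_bound.
Qed.

Lemma sum_pair (R : realType) (I J : finType) (F : I * J -> R) :
  \sum_t F t = \sum_i \sum_j F (i, j).
Proof. by rewrite pair_bigA; apply: eq_bigr => -[]. Qed.

(** * The joint law of past counts and extra samples *)

Section OutcomeMean.
Variables (R : realType) (Omega A : finType) (P : problem R Omega A).
Variables (S : finType) (pi : scheme P S) (k : nat).

Lemma prior_ge0 w : 0 <= prior P w.
Proof. by have /andP[/forallP] := prior_simplex P. Qed.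

Lemma sprob_ge0 w s : 0 <= pi w s.
Proof. by have /andP[/forallP] := sprob_simplex pi w. Qed.

Lemma joint_ge0 t : 0 <= joint pi t.
Proof. by rewrite ffunE mulr_ge0 ?prior_ge0 ?sprob_ge0. Qed.

Lemma sum_sprob w : \sum_s pi w s = 1.
Proof. by have /andP[_ /eqP] := sprob_simplex pi w. Qed.

Lemma sum_joint : \sum_t joint pi t = 1.
Proof.
rewrite sum_pair.
under eq_bigr do under eq_bigr do rewrite ffunE /=.
under eq_bigr do rewrite -mulr_sumr sum_sprob mulr1.
by have /andP[_ /eqP] := prior_simplex P.
Qed.

Lemma sig_prob_gt0 s : 0 < sig_prob pi s.
Proof.
by rewrite /sig_prob; under eq_bigr do rewrite ffunE; exact: sprob_full.
Qed.

Lemma sum_sig_prob : \sum_s sig_prob pi s = 1.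
Proof. by rewrite exchange_big -sum_joint sum_pair. Qed.

Lemma joint_posterior w s : joint pi (w, s) = sig_prob pi s * posterior pi s w.
Proof. by rewrite [posterior _ _ _]ffunE mulrC divfK // gt_eqF // sig_prob_gt0. Qed.

Lemma posterior_ge0 s w : 0 <= posterior pi s w.
Proof. by rewrite ffunE divr_ge0 ?joint_ge0 // ltW // sig_prob_gt0. Qed.

Lemma sum_posterior s : \sum_w posterior pi s w = 1.
Proof.
under eq_bigr do rewrite ffunE.
by rewrite -mulr_suml -/(sig_prob pi s) mulfV // gt_eqF // sig_prob_gt0.
Qed.

Lemma posterior_simplex s : in_simplex (posterior pi s).
Proof.
apply/andP; split; first by apply/forallP => w; apply: posterior_ge0.
by rewrite sum_posterior.
Qed.

Lemma multi_ge0 (T : finType) N (p : {ffun T -> R}) (z : {ffun T -> 'I_N.+1}) :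
  (forall t, 0 <= p t) -> 0 <= multi p z.
Proof.
move=> p0; rewrite /multi; case: ifP => // _.
by rewrite mulr_ge0 ?divr_ge0 ?ler0n // prodr_ge0 // => t _; rewrite exprn_ge0.
Qed.

Lemma outcome_prob_ge0 (o : outcome Omega S k) : 0 <= outcome_prob pi o.
Proof.
rewrite mulr_ge0 ?multi_ge0 //; first exact: joint_ge0.
apply: prodr_ge0 => s _; apply: multi_ge0; exact: posterior_ge0.
Qed.

(** Summing out the samples of the other signals leaves the [k.-1] past rounds and one draw from the
    posterior at [s]. *)
Lemma outcome_mean s (f : {ffun Omega * S -> R}) (g : {ffun Omega -> R}) G :
  \sum_(o : outcome Omega S k) outcome_prob pi o *
     G (lin_stat f o.1 + lin_stat g (o.2 s)) =
  \sum_w posterior pi s w * multi_mean k.-1 (joint pi) f (fun x => G (x + g w)).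
Proof.
pose y s' := posterior pi s'.
transitivity (multi_mean 1 (y s) g
    (fun b => multi_mean k.-1 (joint pi) f (fun x => G (x + b)))); last first.
  rewrite multi_meanS; apply: eq_bigr => w _.
  by rewrite multi_mean0 add0r.
rewrite sum_pair /=.
transitivity (\sum_(Z : {ffun Omega * S -> 'I_k.-1.+1}) \sum_(b : {ffun Omega -> 'I_2})
    multi (y s) b * (multi (joint pi) Z * G (lin_stat f Z + lin_stat g b))); last first.
  rewrite exchange_big; apply: eq_bigr => b _.
  by rewrite -mulr_sumr.
apply: eq_bigr => Z _.
(* The integrand is put into the factor of [s], so the sum over families [Y] becomes a product of
   sums, those for [s' != s] being 1. *)
pose h s' (b : {ffun Omega -> 'I_2}) : R := multi (y s') b *
  (if s' == s then multi (joint pi) Z * G (lin_stat f Z + lin_stat g b) else 1).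
transitivity (\sum_(Y : {ffun S -> {ffun Omega -> 'I_2}}) \prod_s' h s' (Y s')).
  apply: eq_bigr => Y _; rewrite /h big_split /= /outcome_prob /=.
  rewrite [X in _ = _ * X](bigD1 s) //= eqxx [X in _ = _ * (_ * X)]big1.
    by rewrite mulr1; ring.
  by move=> s' /negPf ->.
rewrite -bigA_distr_bigA (bigD1 s) //= [X in _ * X]big1 ?mulr1.
  by apply: eq_bigr => b _; rewrite /h eqxx.
move=> s' /negPf ne.
have := multi_mean_cst 1 [ffun=> 0] 1 (sum_posterior s').
by rewrite /multi_mean => <-; apply: eq_bigr => b _; rewrite /h ne.
Qed.

Lemma sum_joint_signal s (h : Omega -> R) :
  \sum_t joint pi t * ((t.2 == s)%:R * h t.1) =
  sig_prob pi s * \sum_w posterior pi s w * h w.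
Proof.
rewrite sum_pair /=.
rewrite mulr_sumr; apply: eq_bigr => w _.
rewrite (bigD1 s) //= eqxx mul1r big1 ?addr0 ?joint_posterior ?mulrA //.
by move=> s' /negPf ->; rewrite mul0r mulr0.
Qed.

Lemma Prob_mean (E : pred (outcome Omega S k)) :
  Prob pi E = \sum_o outcome_prob pi o * (E o)%:R.
Proof.
rewrite /Prob big_mkcond; apply: eq_bigr => o _.
by case: (E o); rewrite ?mulr1 ?mulr0.
Qed.

Lemma sum_outcome_prob : \sum_(o : outcome Omega S k) outcome_prob pi o = 1.
Proof.
(* [outcome_mean] needs a signal; an empty [S] would make the signal probabilities sum to 0. *)
have [s|S0] := pickP (fun _ : S => true); last first.
  by have := sum_sig_prob; rewrite big_pred0 // => /eqP; rewrite eq_sym oner_eq0.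
move=> _; have := outcome_mean s [ffun=> 0] [ffun=> 0] (fun=> 1).
under eq_bigr do rewrite mulr1.
move=> ->; under eq_bigr do rewrite multi_mean_cst ?sum_joint // mulr1.
exact: sum_posterior.
Qed.

Lemma Prob_ge0 (E : pred (outcome Omega S k)) : 0 <= Prob pi E.
Proof. by apply: sumr_ge0 => o _; apply: outcome_prob_ge0. Qed.

Lemma Prob_le1 (E : pred (outcome Omega S k)) : Prob pi E <= 1.
Proof.
rewrite -sum_outcome_prob Prob_mean; apply: ler_sum => o _.
by case: (E o); rewrite ?mulr1 ?mulr0 // outcome_prob_ge0.
Qed.

Lemma posterior_le1 s w : posterior pi s w <= 1.
Proof.
rewrite -(sum_posterior s) (bigD1 w) //= lerDl sumr_ge0 // => i _.
exact: posterior_ge0.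
Qed.

End OutcomeMean.

(** * Deviation of the count of one state under one signal *)

Section EstimateDeviation.
Variables (R : realType) (Omega A : finType) (P : problem R Omega A).
Variables (S : finType) (pi : scheme P S) (k : nat) (s : S) (l : Omega).
Variables (tau : R) (E : pred (outcome Omega S k)).

Let p : R := sig_prob pi s.
Let y : R := posterior pi s l.
Let N := k.-1.

Definition signal_stat (h : Omega -> R) : {ffun Omega * S -> R} :=
  [ffun t => (t.2 == s)%:R * h t.1].

Lemma lin_stat_signal (h : Omega -> R) (o : outcome Omega S k) :
  lin_stat (signal_stat h) o.1 + lin_stat (finfun h) (o.2 s) =
  \sum_w (nb o w s)%:R * h w.
Proof.
rewrite /lin_stat sum_pair -big_split /=; apply: eq_bigr => w _.
rewrite (bigD1 s) //= !ffunE eqxx mul1r big1 ?addr0; last first.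
  by move=> s' /negPf ne; rewrite ffunE /= ne mul0r mulr0.
by rewrite /nb natrD mulrDl.
Qed.

Lemma sum_posterior_ind c0 c1 :
  \sum_w posterior pi s w * (if w == l then c1 else c0) = y * c1 + (1 - y) * c0.
Proof.
have := sum_posterior pi s; rewrite (bigD1 l) //= -/y => h.
rewrite (bigD1 l) //= eqxx -/y; congr (_ + _).
under eq_bigr => w /negPf -> do [].
by rewrite -mulr_suml; congr (_ * _); rewrite -h; ring.
Qed.

(** Multiplying [tau] by the sample size keeps the condition linear in the counts. *)
Definition frequency_ge_on_event : Prop :=
  forall o, E o -> tau * (\sum_w nb o w s)%N%:R <= (nb o l s)%:R.

(** Markov's inequality at threshold 1: the sample is nonempty and [tau] positive, so [E] forces at
    least one observation of [l]. *)
Lemma Prob_le_expected_count :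
  0 < tau -> frequency_ge_on_event -> Prob pi E <= (1 + N%:R * p) * y.
Proof.
move=> tau_gt0 E_freq; pose h w : R := if w == l then 1 else 0.
have -> : (1 + N%:R * p) * y =
    \sum_(o : outcome Omega S k) outcome_prob pi o * (nb o l s)%:R.
  transitivity (\sum_(o : outcome Omega S k) outcome_prob pi o *
     id (lin_stat (signal_stat h) o.1 + lin_stat (finfun h) (o.2 s))).
    rewrite (@outcome_mean _ _ _ _ _ pi k s (signal_stat h) (finfun h) id).
    under eq_bigr => w _ do rewrite /= multi_mean_id ?sum_joint //.
    under eq_bigr do rewrite mulrDr.
    rewrite big_split /= -mulr_suml sum_posterior mul1r.
    under [X in _ = _ * X + _]eq_bigr do rewrite [signal_stat h _]ffunE.
    rewrite (sum_joint_signal pi s h).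
    under [X in _ = _ + X]eq_bigr do rewrite [finfun h _]ffunE.
    by rewrite /h sum_posterior_ind -/p -/N; ring.
  apply: eq_bigr => o _; rewrite /= lin_stat_signal; congr (_ * _).
  rewrite (bigD1 l) //= /h eqxx mulr1 big1 ?addr0 // => w /negPf ->.
  by rewrite mulr0.
rewrite Prob_mean; apply: ler_sum => o _.
case: (boolP (E o)) => [Eo|_]; last first.
  by rewrite mulr0 mulr_ge0 ?outcome_prob_ge0.
(* The outcome type also contains families where [Y_s] is not a single draw; these have probability
   0. *)
have [sumY|/negPf sumY] := boolP (\sum_w o.2 s w == 1)%N; last first.
  by rewrite /outcome_prob (bigD1 s) //= /multi sumY mul0r mulr0 !mul0r.
apply: ler_wpM2l; first exact: outcome_prob_ge0.
rewrite ler1n lt0n; apply/eqP => nb0.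
have := E_freq o Eo; rewrite nb0 leNgt mulr_gt0 // ltr0n.
under eq_bigr do rewrite /nb.
by rewrite big_split /= (eqP sumY) addn1.
Qed.

(** Let [W] be the count of [l] minus [tau] times the sample size, with mean [a] and variance [V].
    The last hypothesis makes [a] at most a 34th of the standard deviation, and the quartic majorant
    of the indicator of [W >= 0] then has mean at most 63/64. *)
Lemma Prob_le_fourth_moment :
  0 < tau -> tau <= y -> y <= 2^-1 -> frequency_ge_on_event ->
  3 / 4 <= (1 + N%:R * p) * y ->
  34 ^+ 2 * ((1 + N%:R * p) * (y - tau)) ^+ 2 <= (1 + N%:R * p) * y / 2 ->
  Prob pi E <= 63 / 64.
Proof.
move=> tau_gt0 tau_le_y y_le E_freq big_my small_d.
pose n : R := N%:R; pose d : R := y - tau; pose a : R := (1 + n * p) * d.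
have p0 : 0 < p := sig_prob_gt0 pi s.
have p1 : p <= 1.
  rewrite -(sum_sig_prob pi) (bigD1 s) //= lerDl sumr_ge0 // => s' _.
  exact/ltW/sig_prob_gt0.
have n0 : 0 <= n by rewrite ler0n.
have dE : d = y - tau by [].
have d0 : 0 <= d by rewrite subr_ge0.
have np0 : 0 <= n * p by rewrite mulr_ge0 // ltW.
have a0 : 0 <= a by rewrite mulr_ge0 // addr_ge0.
(* [W] adds up [h] over the samples; [fc] and [gc] are the centered increments from a past round and
   from [Y_s]. *)
pose h w : R := if w == l then 1 - tau else - tau.
pose f := signal_stat h; pose g : {ffun Omega -> R} := finfun h.
pose fc : {ffun Omega * S -> R} := [ffun t => f t - p * d].
pose gc : {ffun Omega -> R} := [ffun w => g w - d].
pose q := joint pi.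
pose m2 := \sum_t q t * fc t ^+ 2.
pose m4 := \sum_t q t * fc t ^+ 4.
pose v2 := \sum_w posterior pi s w * gc w ^+ 2.
pose v4 := \sum_w posterior pi s w * gc w ^+ 4.
(* The centered increments lie between -1 and 1, so their fourth moments are at most their second
   moments. *)
have le_pow4 (u : R) : -1 <= u -> u <= 1 -> u ^+ 4 <= u ^+ 2.
  move=> u1 u2; rewrite -subr_ge0.
  have -> : u ^+ 2 - u ^+ 4 = u ^+ 2 * ((1 - u) * (1 + u)) by ring.
  rewrite mulr_ge0 ?sqr_ge0 // mulr_ge0 //; lra.
have bnd (b b' : bool) (u : R) : 0 <= u -> u <= d ->
    -1 <= b%:R * (if b' then 1 - tau else - tau) - u /\
    b%:R * (if b' then 1 - tau else - tau) - u <= 1.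
  by move=> u0 ud; case: b b' => -[]; rewrite /= ?mul1r ?mul0r; split; lra.
have m42 : m4 <= m2.
  apply: ler_sum => t _; apply: ler_wpM2l; first exact: joint_ge0.
  have pd0 : 0 <= p * d by rewrite mulr_ge0 // ltW.
  have pd1 : p * d <= d by rewrite ler_piMl.
  by have [h1 h2] := bnd (t.2 == s) (t.1 == l) _ pd0 pd1; rewrite !ffunE; exact: le_pow4.
have v42 : v4 <= v2.
  apply: ler_sum => t _; apply: ler_wpM2l; first exact: posterior_ge0.
  have [h1 h2] := bnd true (t == l) _ d0 (lexx d); rewrite mul1r in h1 h2.
  by rewrite !ffunE; exact: le_pow4.
have fsum : \sum_t q t * f t = p * d.
  under eq_bigr do rewrite [f _]ffunE.
  rewrite (sum_joint_signal pi s h) sum_posterior_ind -/p /d; ring.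
have fc0 : \sum_t q t * fc t = 0.
  under eq_bigr => t _ do rewrite [fc t]ffunE mulrBr.
  by rewrite sumrB fsum -mulr_suml sum_joint mul1r subrr.
have gc0 : \sum_w posterior pi s w * gc w = 0.
  under eq_bigr => t _ do rewrite [gc t]ffunE [g t]ffunE mulrBr.
  by rewrite sumrB -mulr_suml sum_posterior mul1r sum_posterior_ind /d; ring.
have v2E : v2 = y * (1 - y).
  transitivity (\sum_w posterior pi s w *
     (if w == l then (1 - y) ^+ 2 else y ^+ 2)).
    apply: eq_bigr => w _; congr (_ * _); rewrite !ffunE /h /d.
    by case: ifP => _; ring.
  by rewrite sum_posterior_ind; ring.
have m2E : m2 = p * (y * (1 - tau) ^+ 2 + (1 - y) * tau ^+ 2) - (p * d) ^+ 2.
  transitivity (\sum_t q t * (f t ^+ 2 - 2 * (p * d) * f t + (p * d) ^+ 2)).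
    by apply: eq_bigr => t _; rewrite [fc t]ffunE; congr (_ * _); ring.
  under eq_bigr do rewrite mulrDr mulrBr.
  rewrite big_split sumrB /= -mulr_suml sum_joint mul1r.
  have -> : \sum_i q i * (2 * (p * d) * f i) = 2 * (p * d) * (p * d).
    rewrite -[X in _ = _ * X]fsum mulr_sumr; apply: eq_bigr => t _.
    by rewrite mulrCA.
  have -> : \sum_i q i * f i ^+ 2 = p * (y * (1 - tau) ^+ 2 + (1 - y) * tau ^+ 2).
    transitivity (\sum_t q t * ((t.2 == s)%:R *
        (if t.1 == l then (1 - tau) ^+ 2 else tau ^+ 2))).
      apply: eq_bigr => t _; rewrite [f _]ffunE /h; congr (_ * _).
      case: (t.2 == s); last by rewrite !mul0r expr0n.
      by rewrite !mul1r; case: (t.1 == l); rewrite ?sqrrN.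
    rewrite (sum_joint_signal pi s
      (fun w => if w == l then (1 - tau) ^+ 2 else tau ^+ 2)).
    by rewrite sum_posterior_ind.
  by ring.
pose V := n * m2 + v2.
have y0 : 0 < y by apply: lt_le_trans tau_gt0 tau_le_y.
have m2_ge : p * y / 2 <= m2.
  (* Law of total variance, conditioning on whether the past round shows [s]. *)
  have -> : m2 = p * y * (1 - y) + p * (1 - p) * d ^+ 2 by rewrite m2E /d; ring.
  apply: (@le_trans _ _ (p * y * (1 - y))).
    by rewrite ler_pM2l ?mulr_gt0 //; lra.
  by rewrite lerDl mulr_ge0 ?sqr_ge0 // mulr_ge0 ?subr_ge0 // ltW.
have V_ge : (1 + n * p) * y / 2 <= V.
  have : n * (p * y / 2) <= n * m2 by rewrite ler_wpM2l.
  have : y / 2 <= v2 by rewrite v2E ler_pM2l //; lra.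
  by rewrite /V; lra.
(* A variance bounded away from 0 lets the linear term of [M4 <= V + 3 * V ^+ 2] be absorbed into
   [V ^+ 2]. *)
have V38 : 3 / 8 <= V by rewrite -/n in big_my; lra.
pose M4 := n * m4 + 3 * n * (n - 1) * m2 ^+ 2 + 6 * n * m2 * v2 + v4.
have M4_le : M4 <= 6 * V ^+ 2.
  have h1 : n * m4 <= n * m2 by rewrite ler_wpM2l.
  have h2 : 0 <= n * m2 ^+ 2 by rewrite mulr_ge0 ?sqr_ge0.
  have h3 : M4 <= V + 3 * V ^+ 2.
    have -> : V + 3 * V ^+ 2 = n * m2 + 3 * n * (n - 1) * m2 ^+ 2
       + 6 * n * m2 * v2 + v2 + 3 * (n * m2 ^+ 2) + 3 * v2 ^+ 2 by rewrite /V; ring.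
    have := sqr_ge0 v2; rewrite /M4; lra.
  have : 3 / 8 * V <= V * V by rewrite ler_wpM2r //; lra.
  by rewrite -expr2; lra.
pose sg := Num.sqrt V.
have sg2 : sg ^+ 2 = V by rewrite sqr_sqrtr //; lra.
have sg0 : 0 < sg by rewrite sqrtr_gt0; lra.
have asg : 34 * a <= sg.
  have h34 : (34 * a) ^+ 2 <= sg ^+ 2.
    by rewrite sg2 exprMn; apply: le_trans small_d V_ge.
  have a34 : 34 * a \is Num.nneg by rewrite nnegrE; lra.
  have sg_nneg : sg \is Num.nneg by rewrite nnegrE ltW.
  by rewrite -(ler_pXn2r (ltn0Sn 1) a34 sg_nneg).
pose K := 256 * sg ^+ 4.
have K0 : 0 < K by rewrite mulr_gt0 // exprn_gt0.
pose t := (a + 4 * sg) / 2.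
pose Q x := (x + a) * (x + 4 * sg) * (x - t) ^+ 2.
pose b := 4 * sg.
apply: (@le_trans _ _ (\sum_(o : outcome Omega S k) outcome_prob pi o *
    (fun x => 1 + Q (x - a) / K) (lin_stat f o.1 + lin_stat g (o.2 s)))).
  rewrite Prob_mean; apply: ler_sum => o _.
  apply: ler_wpM2l; first exact: outcome_prob_ge0.
  have asg' : a <= sg by lra.
  set x := lin_stat _ _ + _.
  apply: le_trans (indicator_le_quartic (x - a) sg0 a0 asg').
  case: (boolP (E o)) => [/E_freq Eo|_]; last exact: ler0n.
  suff -> : (- a <= x - a)%R by [].
  rewrite lerBrDl subrr /x /f /g lin_stat_signal.
  have -> : \sum_w (nb o w s)%:R * h w =
      (nb o l s)%:R - tau * (\sum_w nb o w s)%N%:R.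
    rewrite natr_sum mulr_sumr (bigD1 l) //= [in RHS](bigD1 l) //= /h eqxx.
    rewrite opprD -sumrN addrA; congr (_ + _); first by ring.
    by apply: eq_bigr => w /negPf ->; ring.
  by rewrite subr_ge0.
rewrite (@outcome_mean _ _ _ _ _ pi k s f g (fun x => 1 + Q (x - a) / K)).
have -> : \sum_w posterior pi s w * multi_mean k.-1 (joint pi) f
      (fun x => 1 + Q (x + g w - a) / K) =
    \sum_w posterior pi s w * multi_mean N q fc (fun x =>
      (1 + a * b * t ^+ 2 / K) + (2 * t ^+ 3 - 2 * t * a * b) / K * (x + gc w)
      + (a * b - 3 * t ^+ 2) / K * (x + gc w) ^+ 2 + 0 * (x + gc w) ^+ 3
      + K^-1 * (x + gc w) ^+ 4).
  apply: eq_bigr => w _; congr (_ * _).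
  rewrite (multi_mean_center _ _ _ (p * d)); apply: eq_multi_mean => x.
  have -> : x + N%:R * (p * d) + g w - a = x + gc w.
    by rewrite /a [gc w]ffunE /n; ring.
  have bE : b = 2 * t - a by rewrite /b /t; field.
  by rewrite /Q -/b bE; ring.
rewrite multi_mean_quartic_add ?sum_joint ?sum_posterior //.
rewrite -/m2 -/m4 -/v2 -/v4 -/n -/V mul0r addr0 -/M4.
have [r rE] : exists r, a = r * sg by exists (a / sg); rewrite divfK // gt_eqF.
have r0 : 0 <= r by rewrite -(pmulr_lge0 _ sg0) -rE.
have r1 : 34 * r <= 1 by rewrite -(ler_pM2r sg0) mul1r -mulrA -rE.
(* In units of [sg ^+ 4], the left side is a cubic in [r] with value -6 at 0, and the right side is
   -4; [r <= 1/34] keeps the cubic below -4. *)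
suff H : a * b * t ^+ 2 + (a * b - 3 * t ^+ 2) * V + 6 * V ^+ 2 <= - (K / 64).
  have -> : 1 + a * b * t ^+ 2 / K + (a * b - 3 * t ^+ 2) / K * V + K^-1 * M4 =
     1 + (a * b * t ^+ 2 + (a * b - 3 * t ^+ 2) * V + M4) / K by ring.
  rewrite -lerBrDl ler_pdivrMr //; lra.
rewrite -sg2 /K.
have -> : a * b * t ^+ 2 + (a * b - 3 * t ^+ 2) * sg ^+ 2 + 6 * (sg ^+ 2) ^+ 2 =
  sg ^+ 4 * (r * (r + 4) ^+ 2 + 4 * r - 3 / 4 * (r + 4) ^+ 2 + 6).
  by rewrite /b /t rE; field.
have -> : - (256 * sg ^+ 4 / 64) = sg ^+ 4 * (- 4) by field.
rewrite ler_wpM2l ?exprn_ge0 ?(ltW sg0) //.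
have rr : r ^+ 2 <= r by rewrite expr2 ler_piMl //; lra.
have rrr : r * r ^+ 2 <= r by rewrite ler_piMr //; lra.
lra.
Qed.

(** If the expected count of [l] is below 3/4, Markov's bound contradicts the high probability.
    Otherwise a failure of the conclusion, multiplied by the expected sample size, is the smallness
    hypothesis of the fourth-moment bound. *)
Lemma expected_samples_lower_bound :
  0 < tau -> tau <= y -> y <= 2^-1 -> frequency_ge_on_event ->
  63 / 64 < Prob pi E ->
  y <= 2 * 34 ^+ 2 * (1 + N%:R * p) * (y - tau) ^+ 2.
Proof.
move=> tau_gt0 tau_le_y y_le E_freq PE.
have [big_my|] := lerP (3 / 4) ((1 + N%:R * p) * y); last first.
  by have := Prob_le_expected_count tau_gt0 E_freq; lra.
rewrite leNgt; apply/negP => small_d.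
have m0 : 0 < 1 + N%:R * p.
  by rewrite ltr_wpDr // mulr_ge0 ?ler0n // ltW // sig_prob_gt0.
have : Prob pi E <= 63 / 64.
  apply: Prob_le_fourth_moment => //.
  have := ltW small_d; rewrite -(ler_pM2l m0); lra.
by lra.
Qed.
End EstimateDeviation.

(** * The flower game *)

Section PersuasionValue.
Variables (R : realType) (Omega A : finType) (P : problem R Omega A).
Variable act : {ffun Omega -> R} -> A.

Lemma BPR_posterior (S : finType) (pi : scheme P S) :
  BPR act pi = \sum_s sig_prob pi s *
    dotp (uS P (act (posterior pi s))) (posterior pi s).
Proof.
rewrite /BPR; under eq_bigr do rewrite mulr_sumr.
rewrite exchange_big; apply: eq_bigr => s _.
rewrite /dotp mulr_sumr; apply: eq_bigr => w _.
transitivity (joint pi (w, s) * uS P (act (posterior pi s)) w).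
  by rewrite [joint _ _]ffunE mulrA.
by rewrite joint_posterior -mulrA [X in _ * X]mulrC.
Qed.

Lemma BPR_le (S : finType) (pi : scheme P S) c :
  (forall a w, uS P a w <= c) -> BPR act pi <= c.
Proof.
move=> le_c; rewrite BPR_posterior -[c]mul1r -(sum_sig_prob pi) mulr_suml.
apply: ler_sum => s _; apply: ler_wpM2l; first exact/ltW/sig_prob_gt0.
rewrite -[c]mulr1 -(sum_posterior pi s) mulr_sumr.
by apply: ler_sum => w _; apply: ler_wpM2r; first exact: posterior_ge0.
Qed.

(** [sup] dominates the members of a set that is bounded above; the utility bound [c] supplies
    this. *)
Lemma BPR_le_maxBPR (S : finType) (pi : scheme P S) c :
  (forall a w, uS P a w <= c) -> BPR act pi <= maxBPR P act.
Proof.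
move=> le_c; apply: ub_le_sup; last by exists S, pi.
by exists c => _ [S' [pi' ->]]; apply: BPR_le.
Qed.

End PersuasionValue.

(** * Posteriors that favor the sender, and a scheme of value 1/2 *)

Section FlowerGame.
Variables (R : realType) (n : nat) (hn : (2 <= n)%N).

Definition petal_threshold : R := (2 * (n%:R - 1))^-1.
Let tau := petal_threshold.
Let G := flower tau (ltnW hn).

Lemma natr_ge2 : 2 <= n%:R :> R.
Proof. by rewrite (ler_nat R 2 n). Qed.

Lemma petal_thresholdE : (n%:R - 1) * tau = 2^-1.
Proof. by have := natr_ge2; rewrite /tau /petal_threshold => h; field; lra. Qed.

Lemma petal_threshold_gt0 : 0 < tau.
Proof. by have := natr_ge2; rewrite invr_gt0 => h; lra. Qed.

Lemma petal_threshold_le : tau <= 2^-1.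
Proof.
have := natr_ge2; have := petal_threshold_gt0; rewrite -petal_thresholdE => t0 n2.
by rewrite ler_peMl ?(ltW t0) //; lra.
Qed.

Lemma sum_petals (j : 'I_n) (c : R) : \sum_(i | i != j) c = (n%:R - 1) * c.
Proof.
rewrite sumr_const -[LHS]mulr_natl; congr (_ * _).
by rewrite cardC1 card_ord -subn1 natrB // ltnW.
Qed.

Lemma exists_petal (j : 'I_n) : exists l : 'I_n, l != j.
Proof.
have : (0 < #|predC1 j|)%N by rewrite cardC1 card_ord; lia.
by case/card_gt0P => l; exists l.
Qed.

Lemma dotp_basis (j : 'I_n) (x : {ffun 'I_n -> R}) : dotp (basis R j) x = x j.
Proof.
rewrite /dotp (bigD1 j) //= ffunE eqxx mul1r big1 ?addr0 // => i /negPf ne.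
by rewrite ffunE ne mul0r.
Qed.

Lemma dotp_uR_petal jl (x : {ffun 'I_n -> R}) : \sum_i x i = 1 ->
  dotp (uR G (inr jl)) x = x (val jl).1 + tau - x (val jl).2.
Proof.
move=> x1; rewrite -!(dotp_basis _ x) -{1}[tau]mulr1 -x1 mulr_sumr.
rewrite /dotp -big_split -sumrB; apply: eq_bigr => i _ /=.
by rewrite [in LHS]ffunE /=; ring.
Qed.

Lemma dotp_uS_petal jl (x : {ffun 'I_n -> R}) : dotp (uS G (inr jl)) x = 0.
Proof. by rewrite /dotp big1 // => i _; rewrite ffunE mul0r. Qed.

(** Comparing [a_j] with [a_(jl)] gives [tau <= x l]; the coordinates other than [j] then carry at
    least half of the mass. *)
Lemma center_optimalP (x : {ffun 'I_n -> R}) j :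
  in_simplex x -> receiver_optimal G x (inl j) ->
  [/\ forall i, x i <= x j, forall l, tau <= x l & x j <= 2^-1].
Proof.
case/andP => _ /eqP x1 opt.
have le_j i : x i <= x j by have := opt (inl i); rewrite /= !dotp_basis.
have petal l : l != j -> tau <= x l.
  rewrite eq_sym => jl; have := opt (inr (exist _ (j, l) jl)).
  rewrite dotp_uR_petal //= dotp_basis; lra.
split=> // [l|].
  have [->|] := eqVneq l j; last exact: petal.
  by have [i ij] := exists_petal j; apply: le_trans (petal i ij) (le_j i).
have : \sum_(i | i != j) tau <= \sum_(i | i != j) x i.
  by apply: ler_sum => i; apply: petal.
move: x1; rewrite (bigD1 j) //= sum_petals petal_thresholdE; lra.
Qed.

Lemma flower_uS_le1 (a : flower_action n) w : uS G a w <= 1.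
Proof.
by case: a => [j|jl]; rewrite ffunE ?ler01 //= lern1; case: eqP.
Qed.

(** The state is reported truthfully with probability 1/2 and otherwise replaced by a uniform other
    one. By symmetry and the uniform prior, the same matrix gives the posteriors. *)
Definition flower_signal (i : 'I_n) : {ffun 'I_n -> R} :=
  [ffun s => if s == i then 2^-1 else tau].

Lemma flower_signal_simplex i : in_simplex (flower_signal i).
Proof.
apply/andP; split.
  apply/forallP => s; rewrite ffunE; case: ifP => _; first by rewrite invr_ge0.
  exact/ltW/petal_threshold_gt0.
rewrite (bigD1 i) //= ffunE eqxx.
under eq_bigr => s /negPf ne do rewrite ffunE ne.
by rewrite sum_petals petal_thresholdE; apply/eqP; field.
Qed.

Lemma flower_signalC i s : flower_signal i s = flower_signal s i.
Proof. by rewrite !ffunE eq_sym. Qed.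

Lemma flower_signal_prob s :
  \sum_w prior G w * flower_signal w s = n%:R^-1.
Proof.
have /andP[_ /eqP s1] := flower_signal_simplex s.
under eq_bigr do rewrite ffunE flower_signalC.
by rewrite -mulr_sumr s1 mulr1.
Qed.

Lemma flower_signal_full s : 0 < \sum_w prior G w * flower_signal w s.
Proof. by rewrite flower_signal_prob invr_gt0 ltr0n ltnW. Qed.

Definition flower_scheme : scheme G 'I_n :=
  Scheme flower_signal_simplex flower_signal_full.

Lemma flower_sig_prob s : sig_prob flower_scheme s = n%:R^-1.
Proof.
by rewrite -(flower_signal_prob s); apply: eq_bigr => w _; rewrite ffunE.
Qed.

Lemma flower_posterior s : posterior flower_scheme s = flower_signal s.
Proof.
apply/ffunP => w; rewrite ffunE flower_sig_prob ffunE /= ffunE flower_signalC.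
by rewrite mulrC mulKf // invr_eq0 pnatr_eq0 -lt0n ltnW.
Qed.

Lemma flower_center_optimal s : receiver_optimal G (flower_signal s) (inl s).
Proof.
have le12 i : flower_signal s i <= 2^-1.
  by rewrite ffunE; case: ifP => // _; apply: petal_threshold_le.
have ge_tau i : tau <= flower_signal s i.
  by rewrite ffunE; case: ifP => // _; apply: petal_threshold_le.
have ss : flower_signal s s = 2^-1 by rewrite ffunE eqxx.
case=> [j|jl]; rewrite [leRHS]dotp_basis ss ?dotp_basis //.
have /andP[_ /eqP s1] := flower_signal_simplex s.
rewrite dotp_uR_petal //.
have := le12 (val jl).1; have := ge_tau (val jl).2; lra.
Qed.

(** At the posteriors of [flower_scheme] the actions [a_(sl)] tie with [a_s], so the value 1/2 rests
    on sender-favorable tie-breaking. *)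
Lemma half_le_maxBPR act : action_rule G act -> 2^-1 <= maxBPR G act.
Proof.
move=> rule; apply: (@le_trans _ _ (BPR act flower_scheme)); last first.
  exact: BPR_le_maxBPR flower_uS_le1.
rewrite BPR_posterior -[2^-1]mul1r -[X in X * _](sum_sig_prob flower_scheme) mulr_suml.
apply: ler_sum => s _; apply: ler_wpM2l; first exact/ltW/sig_prob_gt0.
rewrite flower_posterior.
have [_ /(_ (inl s) (flower_center_optimal s))] := rule _ (flower_signal_simplex s).
by rewrite dotp_basis ffunE eqxx.
Qed.

End FlowerGame.

Lemma exists_ge_mean (R : realType) (I : finType) (p x : I -> R) c :
  (forall i, 0 < p i) -> \sum_i p i = 1 -> c <= \sum_i p i * x i ->
  exists i, c <= x i.
Proof.
move=> p_gt0 p1 le_c; have [/existsP //|] := boolP [exists i, c <= x i].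
rewrite negb_exists => /forallP x_lt.
have [i _] : exists i : I, true.
  have [i|I0] := pickP (fun _ : I => true); first by exists i.
  by move: p1; rewrite big_pred0 // => /eqP; rewrite eq_sym oner_eq0.
have : \sum_i p i * x i < \sum_i p i * c.
  apply: ltr_sum => [|j _]; first by apply/hasP; exists i; rewrite ?mem_index_enum.
  by rewrite ltr_pM2l // ltNge.
by rewrite -mulr_suml p1 mul1r ltNge le_c.
Qed.

(** To be read with [N] states, [K] past rounds, signal probability [p], and posterior [z] at the
    center and [y] at the tight petal. The bound [p * N <= 3] converts expected samples into
    rounds. *)
Lemma sample_bound_arith (R : realFieldType) (C N K p y z tau eps : R) :
  2 <= N -> 0 <= K -> 0 < p -> 0 <= C -> 0 < eps -> 16 * C * eps ^+ 2 <= 1 ->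
  (N - 1) * tau = 2^-1 -> tau <= y -> (N - 1) * (y - tau) <= 2 * eps ->
  3^-1 <= z -> p * z <= N^-1 ->
  y <= C * (1 + K * p) * (y - tau) ^+ 2 ->
  N ^+ 2 / eps ^+ 2 <= 96 * C * K.
Proof.
move=> N2 K0 p0 C0 e0 Ce tE y_ge y_le z_ge pz bound.
have N0 : 0 < N by lra.
have pN : p * N <= 3.
  have h : p * z * N <= 1 by rewrite -ler_pdivlMr // mul1r.
  have : p * N * 3^-1 <= p * N * z by rewrite ler_pM2l ?mulr_gt0 //; lra.
  by lra.
have m0 : 0 <= 1 + K * p by rewrite addr_ge0 // mulr_ge0 // ltW.
have x2 : ((N - 1) * (y - tau)) ^+ 2 <= (2 * eps) ^+ 2.
  by rewrite ler_pXn2r ?nnegrE // ?mulr_ge0 //; lra.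
have h1 : (N - 1) / 2 <= C * (1 + K * p) * (2 * eps) ^+ 2.
  apply: (@le_trans _ _ (C * (1 + K * p) * ((N - 1) * (y - tau)) ^+ 2)); last first.
    by rewrite ler_wpM2l // mulr_ge0.
  have -> : (N - 1) / 2 = (N - 1) ^+ 2 * tau by rewrite -tE; ring.
  rewrite [leRHS](_ : _ = (N - 1) ^+ 2 * (C * (1 + K * p) * (y - tau) ^+ 2)).
    by rewrite ler_wpM2l ?sqr_ge0 // (le_trans y_ge).
  by ring.
set X := C * eps ^+ 2 in Ce *.
(* The guaranteed sample, the 1 in [1 + K * p], contributes [4 * X <= 1/4], which [2 <= N]
   absorbs. *)
have h2 : N / 8 <= 4 * (X * (K * p)).
  have : C * (1 + K * p) * (2 * eps) ^+ 2 = 4 * X + 4 * (X * (K * p)).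
    by rewrite /X; ring.
  by rewrite -mulrA -/X in Ce; lra.
have XK : 0 <= 4 * (X * K) by rewrite !mulr_ge0 ?exprn_ge0 // ltW.
have h3 : N / 8 * N <= 4 * (X * K) * 3.
  apply: (@le_trans _ _ (4 * (X * K) * (p * N))); last by rewrite ler_wpM2l.
  by move: h2; rewrite -(ler_pM2r N0); lra.
rewrite ler_pdivrMr ?exprn_gt0 //.
have -> : 96 * C * K * eps ^+ 2 = 96 * (X * K) by rewrite /X; ring.
by lra.
Qed.

(** * Choosing a signal and a petal, and bounding the number of rounds *)

Section FlowerInference.
Variables (R : realType) (n : nat) (hn : (2 <= n)%N).
Let tau : R := petal_threshold R n.
Let G := flower tau (ltnW hn).
Variables (act : {ffun 'I_n -> R} -> flower_action n) (S : finType).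
Variables (pi : scheme G S) (k : nat).

Definition signal_reward s := \sum_a dotp (uS G a) (posterior pi s) *
  Prob pi (fun o : outcome 'I_n S k => E_ act a (estimate R o s)).

Definition center_event s (o : outcome 'I_n S k) : bool :=
  [exists j, E_ act (inl j) (estimate R o s)].

(** Petal actions pay the sender nothing, and the events of distinct centers are disjoint because
    [act] is a function. *)
Lemma signal_reward_le s c : (forall j, posterior pi s j <= c) ->
  signal_reward s <= c * Prob pi (center_event s).
Proof.
move=> post_le; rewrite /signal_reward big_sumType /=.
rewrite [X in _ + X]big1 ?addr0; last first.
  by move=> jl _; rewrite (dotp_uS_petal hn jl) mul0r.
under eq_bigr do rewrite dotp_basis.
apply: (@le_trans _ _ (\sum_j c *
    Prob pi (fun o : outcome 'I_n S k => E_ act (inl j) (estimate R o s)))).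
  apply: ler_sum => j _; apply: ler_wpM2r => //.
  by apply: sumr_ge0 => o _; apply: outcome_prob_ge0.
rewrite -mulr_sumr; suff -> : \sum_j Prob pi (fun o : outcome 'I_n S k =>
    E_ act (inl j) (estimate R o s)) = Prob pi (center_event s) by [].
under eq_bigr do rewrite Prob_mean.
rewrite exchange_big Prob_mean; apply: eq_bigr => o _ /=.
rewrite -mulr_sumr; congr (_ * _).
case: (boolP (center_event s o)) => [/existsP[j Ej]|]; last first.
  rewrite negb_exists => /forallP nE.
  by rewrite big1 // => j _; rewrite (negPf (nE j)).
rewrite (bigD1 j) //= Ej big1 ?addr0 // => i ij.
move: Ej => /andP[_ /eqP aj]; rewrite /E_ aj.
suff -> : (inl j == inl i :> flower_action n) = false by rewrite andbF.
by apply/eqP => -[] ji; rewrite ji eqxx in ij.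
Qed.

Lemma center_event_freq s l : action_rule G act ->
  frequency_ge_on_event s l tau (center_event s).
Proof.
move=> rule o /existsP[j /andP[simp /eqP aj]].
have [opt _] := rule _ simp; rewrite aj in opt.
have [_ /(_ l) le_tau _] := center_optimalP simp opt.
move: le_tau; rewrite ffunE.
set M := (\sum_w' _)%N => le_tau.
(* Division by 0 yields 0, so an empty sample would give estimate 0, below [tau]. *)
have M0 : (0 < M)%N.
  rewrite lt0n; apply/eqP => M0.
  have := le_lt_trans le_tau; have := petal_threshold_gt0 R hn.
  by rewrite ltNge -/tau M0 invr0 mulr0 in le_tau *; rewrite le_tau.
by rewrite -ler_pdivlMr ?ltr0n.
Qed.

(* The weight 3 on the known-commitment value makes signals whose posterior is
   not sender-favorable (value 0, reward at most 1) fall short of 2. *)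
Lemma exists_good_signal (eps : R) : action_rule G act -> 4 * eps < 1 ->
  2^-1 - eps <= BPR act pi -> 2^-1 - eps <= IR act k pi ->
  exists s j, [/\ receiver_optimal G (posterior pi s) (inl j),
    2^-1 - 2 * eps <= posterior pi s j &
    1 - 8 * eps <= Prob pi (center_event s)].
Proof.
move=> rule eps_lt hB hI.
pose v s := dotp (uS G (act (posterior pi s))) (posterior pi s).
have [||s hs] := @exists_ge_mean R S (sig_prob pi)
    (fun s => 3 * v s + signal_reward s) (2 - 4 * eps) (sig_prob_gt0 pi).
- exact: sum_sig_prob.
- have -> : \sum_s sig_prob pi s * (3 * v s + signal_reward s) =
      3 * BPR act pi + IR act k pi.
    rewrite BPR_posterior /IR mulr_sumr -big_split; apply: eq_bigr => s _ /=.
    by rewrite mulrDr; congr (_ + _); rewrite -/(v s); ring.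
  by lra.
have simp := posterior_simplex pi s.
have [opt _] := rule _ simp.
have r_le := signal_reward_le (posterior_le1 pi s).
have P1 := Prob_le1 pi (center_event s).
have P0 := Prob_ge0 pi (center_event s).
case aE : (act (posterior pi s)) => [j|jl]; last first.
  have v0 : v s = 0 by rewrite /v aE (dotp_uS_petal hn jl).
  by exfalso; rewrite v0 in hs; lra.
rewrite aE in opt.
have [le_j _ j_le] := center_optimalP simp opt.
have vE : v s = posterior pi s j by rewrite /v aE dotp_basis.
(* Now [v s] is at most 1/2 and the reward at most half the probability of the event, so a total of
   [2 - 4 * eps] forces both to be nearly maximal. *)
have r_le2 := signal_reward_le (fun i => le_trans (le_j i) j_le).
by exists s, j; split => //; rewrite vE in hs; lra.
Qed.

Lemma signal_prob_mul_le s j : sig_prob pi s * posterior pi s j <= n%:R^-1.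
Proof.
rewrite -joint_posterior ffunE /= ffunE ler_piMr ?invr_ge0 ?ler0n //.
rewrite -(sum_sprob pi j) (bigD1 s) //= lerDl sumr_ge0 // => i _.
exact: sprob_ge0.
Qed.

(** The states other than [j] hold mass at most [1/2 + 2 * eps], so their mean excess over [tau] is
    at most [2 * eps / (n - 1)]; one of them does not exceed this mean. *)
Lemma exists_tight_petal s j (eps : R) : receiver_optimal G (posterior pi s) (inl j) ->
  2^-1 - 2 * eps <= posterior pi s j ->
  exists l, (n%:R - 1) * (posterior pi s l - tau) <= 2 * eps.
Proof.
move=> opt yj.
have [/existsP //|] := boolP [exists l, (n%:R - 1) * (posterior pi s l - tau) <= 2 * eps].
rewrite negb_exists => /forallP gt_eps; exfalso.
have n2 := natr_ge2 R hn.
have [l lj] := exists_petal hn j.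
have := sum_posterior pi s; rewrite (bigD1 j) //= => s1.
have : \sum_(i | i != j) 2 * eps <
       \sum_(i | i != j) (n%:R - 1) * (posterior pi s i - tau).
  apply: ltr_sum => [|i _]; last by rewrite ltNge.
  by apply/hasP; exists l; rewrite ?mem_index_enum.
rewrite -[ltRHS]mulr_sumr sumrB !(sum_petals hn) (petal_thresholdE R hn).
rewrite ltr_pM2l; lra.
Qed.

Lemma flower_sample_bound (eps : R) : action_rule G act ->
  0 < eps -> eps <= 1024^-1 ->
  2^-1 - eps <= BPR act pi -> 2^-1 - eps <= IR act k pi ->
  n%:R ^+ 2 / eps ^+ 2 <= 192 * 34 ^+ 2 * k.-1%:R.
Proof.
move=> rule eps0 eps_le hB hI.
have eps4 : 4 * eps < 1 by lra.
have [s [j [opt yj PF]]] := exists_good_signal rule eps4 hB hI.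
have [l yl] := exists_tight_petal opt yj.
have simp := posterior_simplex pi s.
have [le_j ge_tau j_le] := center_optimalP simp opt.
have n2 := natr_ge2 R hn.
have t0 := petal_threshold_gt0 R hn.
have tE := petal_thresholdE R hn.
have PE : 63 / 64 < Prob pi (center_event s) by lra.
have bound := expected_samples_lower_bound t0 (ge_tau l)
  (le_trans (le_j l) j_le) (center_event_freq l rule) PE.
have pj := signal_prob_mul_le s j.
have p0 := sig_prob_gt0 pi s.
have -> : 192 * 34 ^+ 2 * k.-1%:R = 96 * (2 * 34 ^+ 2) * k.-1%:R :> R by ring.
apply: (sample_bound_arith n2 _ p0 _ eps0 _ tE (ge_tau l) yl _ pj bound).
- exact: ler0n.
- by rewrite mulr_ge0 ?exprn_ge0.
(* With [C = 2 * 34 ^+ 2], the quantity [16 * C * eps ^+ 2] is [32 * (34 * eps) ^+ 2], and 34/1024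
   is below 1/30. *)
- have : (34 * eps) ^+ 2 <= 30^-1 ^+ 2 by rewrite ler_pXn2r // ?nnegrE; lra.
  by lra.
- by lra.
Qed.

End FlowerInference.

Theorem theorem1 (R : realType) :
  exists (c eps0 : R), 0 < c /\ 0 < eps0 /\
  forall (n : nat) (hn : (2 <= n)%N) (eps : R) (k : nat)
    (act : {ffun 'I_n -> R} -> flower_action n) (S : finType)
    (pi : scheme (flower (2 * (n%:R - 1))^-1 (ltnW hn)) S),
    0 < eps -> eps <= eps0 -> (1 <= k)%N ->
    action_rule (flower (2 * (n%:R - 1))^-1 (ltnW hn)) act ->
    BPR act pi >= maxBPR (flower (2 * (n%:R - 1))^-1 (ltnW hn)) act - eps ->
    IR act k pi >= maxBPR (flower (2 * (n%:R - 1))^-1 (ltnW hn)) act - eps ->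
    k%:R >= c * (n%:R / (eps ^+ 2 * (eps + n%:R^-1))).
Proof.
(* The factor 192 is [96 * 2]; [eps <= 1024^-1] puts [1 - 8 * eps] above 63/64. *)
exists (192 * 34 ^+ 2)^-1, 1024^-1; split; first by rewrite invr_gt0 mulr_gt0 ?exprn_gt0.
split=> [|n hn eps k act S pi eps_gt0 eps_le _ rule hB hI]; first by rewrite invr_gt0.
have half_le := half_le_maxBPR rule.
have k_ge : n%:R ^+ 2 / eps ^+ 2 <= 192 * 34 ^+ 2 * k.-1%:R.
  apply: flower_sample_bound rule eps_gt0 eps_le _ _.
    by apply: le_trans hB; rewrite lerB.
  by apply: le_trans hI; rewrite lerB.
have n_gt0 : 0 < n%:R :> R by rewrite ltr0n ltnW.
rewrite mulrC ler_pdivrMr; last by rewrite mulr_gt0 ?exprn_gt0.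
(* The bound obtained has denominator [eps ^+ 2 * n%:R^-1]; enlarging [n%:R^-1] to [eps + n%:R^-1]
   weakens it to the stated one. *)
rewrite [leRHS]mulrC; apply: (@le_trans _ _ (n%:R ^+ 2 / eps ^+ 2)).
  have -> : n%:R ^+ 2 / eps ^+ 2 = n%:R / (eps ^+ 2 * n%:R^-1).
    by field; rewrite gt_eqF // gt_eqF.
  rewrite ler_pM2l // lef_pV2 ?posrE ?mulr_gt0 ?exprn_gt0 ?invr_gt0 //.
    by rewrite ler_pM2l ?exprn_gt0 // lerDr ltW.
  by rewrite addr_gt0 // invr_gt0.
apply: le_trans k_ge _; rewrite ler_wpM2l ?mulr_ge0 ?exprn_ge0 //.
by rewrite ler_nat leq_pred.
Qed.
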